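(* Let $\alpha\in(0,1)$, let $f:\mathbb{R}\to\mathbb{R}$ be a function and $x_{0}\in\mathbb{R}$. Then the fractional system \[ {}^{c}_{0}D_{t}^{\alpha}x(t)=f(x(t)),\quad t\geq 0,\qquad x(0)=x_{0}, \] has no nonconstant periodic solution $x:[0,\infty)\to\mathbb{R}$.
   Context: For $\alpha\in(0,1)$, the Caputo fractional derivative of order $\alpha$ is $({}^{c}_{0}D_{t}^{\alpha}x)(t)=\frac{1}{\Gamma(1-\alpha)}\int_{0}^{t}(t-\tau)^{-\alpha}x'(\tau)\,d\tau$, i.e. the Riemann–Liouville fractional integral of order $1-\alpha$ applied to $x'$ (where $x'$ is locally integrable). A solution is a function $x$ on $[0,\infty)$ for which this derivative is defined and the equation and initial condition hold; it is periodic if $x(t+T)=x(t)$ for all $t\ge 0$ for some $T>0$. *)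

(* Defs.v *)
From mathcomp Require Import all_boot all_order all_algebra.
From mathcomp Require Import all_classical all_reals all_analysis.
Set Implicit Arguments. Unset Strict Implicit. Unset Printing Implicit Defensive.
Import Order.TTheory GRing.Theory Num.Theory.
Import numFieldNormedType.Exports.
Local Open Scope classical_set_scope.
Local Open Scope ring_scope.

Definition Gamma {R : realType} (z : R) : R :=
  Rintegral lebesgue_measure `]0%R, +oo[ (fun s : R => s `^ (z - 1) * expR (- s)).

Definition caputo {R : realType} (alpha : R) (x : R -> R) (t : R) : R :=
  (Gamma (1 - alpha))^-1 *
  Rintegral lebesgue_measure `[0%R, t] (fun tau : R => (t - tau) `^ (- alpha) * derive1 x tau).

Definition caputo_solution {R : realType} (alpha : R) (f : R -> R) (x0 : R)
    (x : R -> R) : Prop :=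
  [/\ (forall t : R, 0 < t -> derivable x t 1),
      (forall t : R, 0 <= t ->
         lebesgue_measure.-integrable `[0%R, t] (fun tau : R => (derive1 x tau)%:E)),
      (forall t : R, 0 <= t ->
         lebesgue_measure.-integrable `[0%R, t]
           (fun tau : R => ((t - tau) `^ (- alpha) * derive1 x tau)%:E)),
      (forall t : R, 0 <= t -> caputo alpha x t = f (x t)) &
      x 0 = x0].

Definition periodic_on_nonneg {R : realType} (x : R -> R) : Prop :=
  exists T : R, 0 < T /\ forall t : R, 0 <= t -> x (t + T) = x t.

Definition nonconstant_on_nonneg {R : realType} (x : R -> R) : Prop :=
  exists t1 t2 : R, [/\ 0 <= t1, 0 <= t2 & x t1 <> x t2].

(* Main.v *)
Require Import Defs.
From mathcomp Require Import all_boot all_order all_algebra.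
From mathcomp Require Import all_classical all_reals all_analysis.
From mathcomp Require Import measurable_realfun lra ring.

(** Write y = x'. Since C f(x(t)) is T-periodic for the constant
    C = Gamma (1 - alpha) <> 0, comparing the Caputo integrals at u and at
    u - T, and shifting one period in the first, leaves
    int_0^T (u - t)^(-alpha) y(t) dt = 0 for every u > T: the memory of a full
    period vanishes identically. Differentiating in u, all the integrals
    int_0^T (u - t)^(-alpha - k) y(t) dt vanish; at u = 2T these are the moments
    of (2T - t)^(-alpha) y(t) with respect to 1/(2T - t), so y = 0 almost
    everywhere. A function that is differentiable at every point and whose
    derivative vanishes almost everywhere is constant. *)

Set Implicit Arguments. Unset Strict Implicit. Unset Printing Implicit Defensive.
Import Order.TTheory GRing.Theory Num.Theory.
Import numFieldNormedType.Exports.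
Local Open Scope classical_set_scope.
Local Open Scope ring_scope.

(** * Differentiable functions whose derivative vanishes almost everywhere *)

(** Real induction in the manner of Cousin: local gauges of varying size are glued along [[a, b]] by
    looking at the supremum of the points reached from [a]. *)
Lemma cousin (R : realType) (P : R -> R -> Prop) (a b : R) : a <= b ->
  (forall u v w, u <= v -> v <= w -> P u v -> P v w -> P u w) ->
  (forall t, a <= t <= b -> exists2 d, 0 < d &
     forall u v, t - d < u -> u <= t -> t <= v -> v < t + d -> P u v) ->
  P a b.
Proof.
move=> ab Ptrans Ploc.
pose S := [set t | a <= t <= b /\ P a t].
have Sa : S a.
  split; first by rewrite lexx.
  have [|d d0 dP] := Ploc a; first by rewrite lexx.
  by apply: dP; lra.
have hsS : has_sup S by split; [exists a | exists b => t [/andP[]]].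
have ac : a <= sup S by apply: sup_upper_bound.
have cb : sup S <= b by apply: ge_sup; [exists a | move=> t [/andP[]]].
have [|d d0 dP] := Ploc (sup S); first by rewrite ac.
have [s [/andP[as_ sb] Pas] cs] := sup_adherent d0 hsS.
have sc : s <= sup S by apply: sup_upper_bound => //; split=> //; rewrite as_.
(* If [sup S] were below [b], this [v] would be a point of [S] beyond [sup S]; hence [v] can only be
   [b]. *)
pose v := Num.min b (sup S + d / 2).
have cv : sup S <= v by rewrite le_min cb /=; lra.
have vd : v < sup S + d by rewrite gt_min; apply/orP; right; lra.
have Pav : P a v.
  apply: (Ptrans a s v) => //; first exact: le_trans cv.
  by apply: dP.
have : v <= sup S.
  apply: sup_upper_bound => //; split=> //.
  by rewrite (le_trans ac cv) /= ge_min lexx.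
rewrite /v ge_min => /orP[bc|]; last by lra.
by have -> : b = v by apply/esym/min_idPl; apply: (le_trans bc); lra.
Qed.

(** The slack [c - |x'(t)|] is the tolerance allowed to the difference quotient. The radius depends
    on [t], so passing to a whole interval calls for [cousin]. *)
Lemma derivable_lipschitz_pt (R : realType) (x : R -> R) (t c : R) :
  derivable x t 1 -> `|derive1 x t| < c ->
  exists2 d, 0 < d & forall v, `|v - t| < d -> `|x v - x t| <= c * `|v - t|.
Proof.
move=> dx xc.
have e0 : 0 < c - `|derive1 x t| by rewrite subr_gt0.
have cv : h^-1 *: ((x \o shift t) h%:A - x t) @[h --> 0^'] --> derive1 x t.
  by rewrite derive1E; exact: dx.
move/cvgrPdist_le : cv => /(_ _ e0).
move=> [d /= d0 dP].
exists d => // v vd.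
have [->|vt] := eqVneq v t; first by rewrite !subrr normr0 mulr0.
have := dP (v - t); rewrite /ball_ /= sub0r normrN subr_eq0 => /(_ vd vt).
rewrite /shift scaler1 subrK => H.
have vt0 : v - t != 0 by rewrite subr_eq0.
have : `|(v - t)^-1 *: (x v - x t)| <= c.
  rewrite -[X in `|X|](subrKC (derive1 x t)).
  by apply: (le_trans (ler_normD _ _)); rewrite distrC in H; lra.
by rewrite /GRing.scale /= normrM normfV mulrC ler_pdivrMr ?normr_gt0.
Qed.

(* Outer regularity gives open sets [U n] containing the exceptional null set and
   so small that weighting [U n] by [n + 1] costs at most [e / 2] in total. The
   increment of [x] is then dominated locally, hence (by [cousin]) globally, by
   the additive interval function [psi]. *)
Lemma ae_derive1_eq0_eq (R : realType) (x : R -> R) (a b : R) : a <= b ->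
  (forall t, a <= t <= b -> derivable x t 1) ->
  {ae lebesgue_measure, forall t, a <= t <= b -> derive1 x t = 0} ->
  x a = x b.
Proof.
move=> ab dx [N [mN N0 subN]].
apply/eqP; rewrite eq_sym -subr_eq0 -normr_le0; apply/ler_addgt0Pr => e e0.
rewrite add0r.
(* The summand 1 keeps the denominator positive when [a = b]; the linear term [d * (b - a)] stays
   below [e / 2]. *)
pose d := e / (2 * (1 + (b - a))).
have d0 : 0 < d by rewrite divr_gt0// mulr_gt0//; lra.
have dn0 n : 0 < (e / 2) / (2 ^ n.+1)%:R / n.+1%:R.
  by rewrite !divr_gt0.
have /choice[U HU] : forall n, exists U : set R, [/\ open U, N `<=` U &
    (n.+1%:R%:E * lebesgue_measure U <= ((e / 2) / (2 ^ n.+1)%:R)%:E)%E].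
  move=> n.
  have Noo : (lebesgue_measure N < +oo)%E by rewrite N0 ltry.
  have [U [oU NU UNe]] := lebesgue_regularity_outer mN Noo (dn0 n).
  exists U; split=> //.
  have -> : U = (U `\` N) `|` N by rewrite setDKU.
  rewrite measureU//; last 2 first.
    by apply: measurableD => //; exact: open_measurable.
    by rewrite setDKI.
  rewrite [X in (_ + X)%E]N0 adde0.
  rewrite -[leRHS]fineK// -lee_pdivlMl//.
  by rewrite -EFinM mulrC; exact: ltW.
have mU n A : measurable A -> measurable (U n `&` A).
  by move=> mA; apply: measurableI => //; apply: open_measurable; case: (HU n).
(* Half-open intervals tile without overlap, so [g], and with it [psi], is exactly additive. *)
pose g u v n := (n.+1%:R%:E * lebesgue_measure (U n `&` `]u, v]))%E.
have g0 u v n : (0 <= g u v n)%E by rewrite mule_ge0.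
pose psi u v := ((d * (v - u))%:E + \sum_(0 <= n <oo) g u v n)%E.
have : (`|x b - x a|%:E <= psi a b)%E.
  apply: (@cousin R (fun u v => (`|x v - x u|%:E <= psi u v)%E) a b ab).
    move=> u v w uv vw Puv Pvw.
    have -> : psi u w = (psi u v + psi v w)%E.
      rewrite /psi.
      have -> : d * (w - u) = d * (v - u) + d * (w - v) by ring.
      rewrite EFinD addeACA; congr (_ + _)%E.
      rewrite -nneseriesD//; apply: eq_eseriesr => n _.
      rewrite /g -ge0_muleDr//; congr (_ * _)%E.
      rewrite -measureU//; [|exact: mU|exact: mU|].
        rewrite -setIUr; congr (lebesgue_measure (_ `&` _)).
        by apply: itv_bndbnd_setU; rewrite bnd_simp.
      rewrite setIACA setIid (_ : `]u, v] `&` `]v, w] = set0) ?setI0//.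
      apply/seteqP; split => // t /= []; rewrite !in_itv /=.
      by move=> /andP[_ tv] /andP[/lt_le_trans/(_ tv)]; rewrite ltxx.
    apply: le_trans (leeD Puv Pvw).
    rewrite -EFinD lee_fin.
    have -> : x w - x u = (x v - x u) + (x w - x v) by ring.
    exact: ler_normD.
  (* Since [t] lies between [u] and [v], the one-point estimates on its two sides add up to a slope
     bound on [[u, v]]. *)
  have key t c dl : (forall v, `|v - t| < dl -> `|x v - x t| <= c * `|v - t|) ->
     forall u v, t - dl < u -> u <= t -> t <= v -> v < t + dl ->
       `|x v - x u| <= c * (v - u).
    move=> H u v u1 u2 v1 v2.
    have Hv : `|x v - x t| <= c * (v - t).
      by have := H v; rewrite ger0_norm ?subr_ge0//; apply; lra.
    have Hu : `|x t - x u| <= c * (t - u).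
      have := H u; rewrite distrC ger0_norm ?subr_ge0// => Hu.
      by rewrite distrC; apply: Hu; lra.
    have -> : x v - x u = (x v - x t) + (x t - x u) by ring.
    by apply: (le_trans (ler_normD _ _)); lra.
  move=> t tab; have dxt := dx t tab.
  have [Nt|Nt] := pselect (N t); last first.
    have xt0 : derive1 x t = 0.
      by apply: contrapT => H; apply: Nt; apply: subN => /(_ tab).
    have [|dl dl0 Hdl] := @derivable_lipschitz_pt _ x t d dxt.
      by rewrite xt0 normr0.
    exists dl => // u v u1 u2 v1 v2.
    apply: (@le_trans _ _ (d * (v - u))%:E).
      by rewrite lee_fin; exact: (key t d dl).
    by rewrite /psi leeDl//; apply: nneseries_ge0.
  (* [n.+1] exceeds the slope at [t], and near [t] all of []u, v]] lies in [U n], so the single term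
     [g u v n] dominates the increment. *)
  pose n := Num.trunc `|derive1 x t|.
  have [|dl dl0 Hdl] := @derivable_lipschitz_pt _ x t n.+1%:R dxt.
    by rewrite truncnS_gt.
  have [oU NU _] := HU n.
  have [r /= r0 Hr] : nbhs t (U n) by apply: open_nbhs_nbhs; split => //; exact: NU.
  exists (Num.min r dl); first by rewrite lt_min r0.
  move=> u v u1 u2 v1 v2.
  have rl : Num.min r dl <= r by rewrite ge_min lexx.
  have dll : Num.min r dl <= dl by rewrite ge_min lexx orbT.
  apply: (@le_trans _ _ (n.+1%:R * (v - u))%:E).
    by rewrite lee_fin; apply: (key t _ dl) => //; lra.
  apply: (@le_trans _ _ (\sum_(0 <= n <oo) g u v n)%E); last first.
    by rewrite /psi leeDr// lee_fin mulr_ge0 ?(ltW d0)//; lra.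
  apply: (@le_trans _ _ (g u v n)); last first.
    apply: le_trans (nneseries_lim_ge n.+1 _) => //.
    by rewrite big_nat_recr//= leeDr//; apply: sume_ge0.
  rewrite /g (_ : _ `&` _ = `]u, v]%classic); last first.
    apply/setIidr => s /=; rewrite in_itv /= => /andP[us sv].
    by apply: Hr; rewrite /ball_ /= ltr_distl; apply/andP; split; lra.
  rewrite EFinM lee_wpmul2l ?lee_fin//.
  rewrite lebesgue_measure_itv /= lte_fin.
  case: ifPn; first by rewrite EFinB.
  by rewrite -leNgt => vu; rewrite lee_fin; lra.
rewrite -lee_fin => /le_trans; apply.
have : (\sum_(0 <= n <oo) g a b n <= (e / 2)%:E)%E.
  (* The geometric weights sum to [e / 2]; the added 0 matches the form of [epsilon_trick]. *)
  apply: (@le_trans _ _ (\sum_(0 <= n <oo) (0 + ((e / 2) / (2 ^ n.+1)%:R)%:E))%E).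
    apply: lee_nneseries => // n _; rewrite add0e.
    have [oU _ Ue] := HU n; apply: le_trans Ue.
    rewrite lee_wpmul2l ?lee_fin// le_measure// inE//; [exact: mU|].
    exact: open_measurable.
  apply: le_trans (epsilon_trick _ _ _) _ => //; first by rewrite ltW// divr_gt0.
  by rewrite eseries0// add0e.
move=> /(leeD2l (d * (b - a))%:E) /le_trans; apply.
rewrite -EFinD lee_fin.
have : d * (1 + (b - a)) = e / 2 by rewrite /d; field; lra.
by rewrite mulrDr mulr1; lra.
Qed.

(** * From vanishing moments to vanishing functions *)

Lemma integrable_bounded_mul d (T : measurableType d) (R : realType)
    (mu : {measure set T -> \bar R}) (D : set T) (h z : T -> R) (C : R) :
  measurable D -> measurable_fun D h ->
  (forall t, D t -> `|h t| <= C) ->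
  mu.-integrable D (EFin \o z) ->
  mu.-integrable D (EFin \o (fun t => h t * z t)).
Proof.
move=> mD mh hC iz.
have -> : EFin \o (fun t => h t * z t) = ((EFin \o h) \* (EFin \o z))%E.
  by apply/funext => t /=; rewrite EFinM.
apply: integrableMr => //; exists C; split; first exact: num_real.
by move=> y Cy t Dt; apply: (le_trans (hC _ Dt)); rewrite ltW.
Qed.

Lemma bernoulli_ge (R : realFieldType) (a : R) (m : nat) : 0 <= a <= 1 ->
  1 - m%:R * a <= (1 - a) ^+ m.
Proof.
move=> /andP[a0 a1]; elim: m => [|m IH]; first by rewrite mul0r subr0 expr0.
rewrite exprS; apply: (@le_trans _ _ ((1 - a) * (1 - m%:R * a))).
  rewrite -natr1; have : 0 <= m%:R * (a * a) by rewrite !mulr_ge0.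
  by nra.
by rewrite ler_wpM2l// subr_ge0.
Qed.

(** The induction rests on [(1 - a) (1 + (m + 1) a) <= 1 + m a]. *)
Lemma bernoulli_le (R : realFieldType) (a : R) (m : nat) : 0 <= a <= 1 ->
  (1 - a) ^+ m * (1 + m%:R * a) <= 1.
Proof.
move=> /andP[a0 a1]; elim: m => [|m IH]; first by rewrite mul0r addr0 expr0 mulr1.
apply: le_trans IH; rewrite exprSr -mulrA ler_wpM2l ?exprn_ge0 ?subr_ge0//.
rewrite -natr1; have : 0 <= m%:R * (a * a) by rewrite !mulr_ge0.
have : 0 <= a * a by rewrite mulr_ge0.
by nra.
Qed.

(** Bernoulli gives the lower bound [1 - (2 v) ^ n], and [2 v < 1]. *)
Lemma cvg_step_lt (R : realType) (v : R) : 0 <= v < 1/2 ->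
  (1 - v ^+ n) ^+ (2 ^ n) @[n --> \oo] --> (1 : R).
Proof.
move=> /andP[v0 v1].
have vn n : 0 <= v ^+ n <= 1 by rewrite exprn_ge0//= exprn_ile1//; lra.
apply: (@squeeze_cvgr _ \oo _ _ (fun n => 1 - (2 * v) ^+ n) (fun=> 1)).
- near=> n; apply/andP; split.
    by apply: le_trans (bernoulli_ge _ (vn n)); rewrite exprMn natrX.
  by rewrite exprn_ile1//; have := vn n; lra.
- rewrite -[X in _ --> X]subr0; apply: cvgB; first exact: cvg_cst.
  by apply: cvg_expr; rewrite ger0_norm; lra.
- exact: cvg_cst.
Unshelve. all: by end_near. Qed.

(** Here [bernoulli_le] gives the upper bound [1 / (1 + (2 v) ^ n)], which is below [(2 v) ^ - n]
    with [2 v > 1]. *)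
Lemma cvg_step_gt (R : realType) (v : R) : 1/2 < v <= 1 ->
  (1 - v ^+ n) ^+ (2 ^ n) @[n --> \oo] --> (0 : R).
Proof.
move=> /andP[v0 v1].
have vn n : 0 <= v ^+ n <= 1 by rewrite exprn_ge0 ?exprn_ile1//; lra.
apply: (@squeeze_cvgr _ \oo _ _ (fun=> 0) (fun n => ((2 * v)^-1) ^+ n)).
- near=> n; apply/andP; split.
    by rewrite exprn_ge0//; have := vn n; lra.
  have v20 : 0 < (2 * v) ^+ n by rewrite exprn_gt0//; lra.
  rewrite exprVn -[leRHS]mul1r ler_pdivlMr//.
  apply: le_trans (bernoulli_le (2 ^ n) (vn n)).
  rewrite ler_wpM2l ?exprn_ge0 ?subr_ge0//; first by have := vn n; lra.
  by rewrite exprMn natrX; lra.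
- exact: cvg_cst.
- apply: cvg_expr; rewrite ger0_norm ?invr_ge0; last by lra.
  by rewrite invf_lt1; lra.
Unshelve. all: by end_near. Qed.

(* [(1 - q ^ n) ^ (2 ^ n)] is a polynomial in [q] tending boundedly to the
   indicator function of [q < 1/2]. *)
Lemma moments_eq0 d (T : measurableType d) (R : realType)
    (mu : {measure set T -> \bar R}) (D : set T) (q z : T -> R) :
  measurable D -> measurable_fun D q ->
  (forall t, D t -> 0 <= q t <= 1) ->
  {ae mu, forall t, D t -> q t != 1/2} ->
  mu.-integrable D (EFin \o z) ->
  (forall k, \int[mu]_(t in D) (q t ^+ k * z t) = 0) ->
  \int[mu]_(t in D `&` [set t | q t < 1/2]) z t = 0.
Proof.
move=> mD mq q01 qh iz mom.
have qn n t : D t -> 0 <= q t ^+ n <= 1.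
  by move=> /q01 /andP[q0 q1]; rewrite exprn_ge0// exprn_ile1.
have mp n m : measurable_fun D (fun t => (1 - q t ^+ n) ^+ m).
  by apply: measurable_funX; apply: measurable_funB => //; exact: measurable_funX.
have ip k n m :
    mu.-integrable D (EFin \o (fun t => q t ^+ k * ((1 - q t ^+ n) ^+ m * z t))).
  apply: (@integrable_bounded_mul _ _ _ _ _ _ _ 1) => //.
  - exact: measurable_funX.
  - by move=> t Dt; have /andP[? ?] := qn k t Dt; rewrite ger0_norm.
  apply: (@integrable_bounded_mul _ _ _ _ _ _ _ 1) => //.
  move=> t Dt; have /andP[? ?] := qn n t Dt.
  by rewrite ger0_norm ?exprn_ge0 ?exprn_ile1//; lra.
(* Splitting one factor [1 - q ^ n] off the power turns exponent [k] into [k] and [k + n], so the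
   induction on [m] must keep [k] general. *)
have int0 n m : forall k,
    \int[mu]_(t in D) (q t ^+ k * ((1 - q t ^+ n) ^+ m * z t)) = 0.
  elim: m => [|m IH] k.
    by rewrite -[RHS](mom k); apply: eq_Rintegral => t _; rewrite expr0 mul1r.
  rewrite -[RHS]subr0 -[X in _ = X - _](IH k) -[X in _ = _ - X](IH (k + n)%N).
  rewrite -RintegralB//; apply: eq_Rintegral => t _.
  by rewrite exprD exprS; ring.
pose A := D `&` [set t | q t < 1/2].
have mA : measurable A.
  have -> : A = D `&` q @^-1` `]-oo, 1/2[.
    by apply/seteqP; split => t; rewrite /A /= in_itv.
  exact: mq.
pose F n t := ((1 - q t ^+ n) ^+ (2 ^ n) * z t)%:E.
have mz : measurable_fun D z by case/integrableP : iz => /measurable_EFinP.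
have [] := @dominated_convergence _ _ _ mu D mD F
  (fun t => ((z \_ A) t)%:E) (fun t => `|(z t)%:E|%E).
- by move=> n; apply/measurable_EFinP/measurable_funM.
- apply/measurable_EFinP/measurable_restrict => //.
  by apply: measurable_funS mz => //; exact: subIsetr.
(* The pointwise limit is 1 or 0 according to the side of 1/2 on which [q t] lies. The level 1/2
   itself, where the limit would be [exp(-1)], is excluded almost everywhere. *)
- apply: filterS qh => t qt Dt; apply: cvg_EFin; first exact: nearW.
  rewrite /F /comp /= patchE; have [q0 q1] := andP (q01 t Dt).
  case: ifPn => [/set_mem[_ /= tA]|tA].
    rewrite -[X in _ --> X]mul1r; apply: cvgM; last exact: cvg_cst.
    by apply: cvg_step_lt; rewrite q0.
  rewrite -[X in _ --> X](mul0r (z t)); apply: cvgM; last exact: cvg_cst.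
  apply: cvg_step_gt; rewrite q1 andbT lt_neqAle eq_sym qt//= leNgt.
  by apply/negP => qt2; move/negP: tA; apply; rewrite inE.
- exact: integrable_abse.
- apply: aeW => t n Dt; rewrite /F lee_fin normrM ler_piMl//.
  have /andP[? ?] := qn n t Dt.
  by rewrite ger0_norm ?exprn_ge0 ?exprn_ile1//; lra.
move=> iA _; rewrite -(fineK (integrable_fin_num mD iA)) => /fine_cvg cv.
rewrite Rintegral_mkcondr.
transitivity (\int[mu]_(t in D) (z \_ A) t).
  apply: eq_Rintegral => t Dt; rewrite !patchE; congr (if _ then _ else _).
  by rewrite /A in_setI Dt.
apply: (cvg_unique _ cv) => //.
rewrite (_ : _ \o _ = fun=> 0); first exact: cvg_cst.
apply/funext => n /=; rewrite -[RHS](int0 n (2 ^ n)%N 0%N).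
by rewrite /Rintegral; congr fine; apply: eq_integral => t _; rewrite /F expr0 mul1r.
Qed.

(** By Lebesgue differentiation the primitive has derivative [z] almost everywhere, and here the
    primitive is identically zero. *)
Lemma itv_integral_eq0_ae (R : realType) (a b : R) (z : R -> R) :
  lebesgue_measure.-integrable `]a, b[ (EFin \o z) ->
  (forall s, a < s < b -> \int[lebesgue_measure]_(t in `]a, s]) z t = 0) ->
  {ae lebesgue_measure, forall t, a < t < b -> z t = 0}.
Proof.
move=> iz z0.
have mab : measurable (`]a, b[%classic : set R) by [].
(* Extension by zero lets the primitive start at minus infinity, as [FTC1Ny] requires. *)
pose f := z \_ `]a, b[.
have if_ D : measurable D -> lebesgue_measure.-integrable D (EFin \o f).
  move=> mD; apply: (integrableS measurableT) => //.
  by rewrite /f -restrict_EFin; apply: (integrable_mkcond _ _).1.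
have := FTC1Ny (fun y => if_ _ (measurable_itv `]-oo, y])) (integrable_locally mab iz).
apply: filterS; first exact: (ae_filter_ringOfSetsType lebesgue_measure).
move=> t [_ +] tab.
have ft s : a < s < b -> \int[lebesgue_measure]_(t in `]-oo, s]) f t = 0.
  move=> sab; rewrite -Rintegral_mkcondr (_ : _ `&` _ = `]a, s]%classic); first exact: z0.
  apply/seteqP; split => u /=; rewrite !in_itv /=; first by move=> [-> /andP[->]].
  by move=> /andP[-> us]; split=> //; lra.
have -> : z t = f t by rewrite /f patchE mem_set//= in_itv.
move=> <-; rewrite derive1E (@near_eq_derive _ _ _ _ (cst 0)) ?derive_cst ?oner_neq0//.
near=> s; rewrite ft//; apply/andP; split; near: s.
  by apply: lt_nbhsr; case/andP: tab.
by apply: lt_nbhsl; case/andP: tab.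
Unshelve. all: by end_near. Qed.

(** * Power kernels and differentiation in their parameter *)

Lemma le0_ler_powR (R : realType) (p x y : R) : p <= 0 -> 0 < x -> x <= y ->
  y `^ p <= x `^ p.
Proof.
move=> p0 x0 xy; have y0 := lt_le_trans x0 xy.
have q0 : 0 <= - p by rewrite oppr_ge0.
rewrite -(opprK p); move: (- p) q0 => q q0.
rewrite !powRN lef_pV2 ?posrE ?powR_gt0//.
by apply: (ge0_ler_powR _ _ _ xy); rewrite ?nnegrE// ltW.
Qed.

Section power_kernel.
Variables (R : realType) (a b : R) (y : R -> R).
Hypothesis iy : lebesgue_measure.-integrable `]a, b[ (EFin \o y).

Lemma integrable_powR_kernel (p u : R) : p <= 0 -> b < u ->
  lebesgue_measure.-integrable `]a, b[ (EFin \o (fun t => (u - t) `^ p * y t)).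
Proof.
move=> p0 bu.
apply: (@integrable_bounded_mul _ _ _ _ _ _ _ ((u - b) `^ p)) => //.
  by apply: (measurableT_comp (measurable_powR p)); exact: measurable_funB.
move=> t /=; rewrite in_itv /= => /andP[_ tb].
by rewrite ger0_norm ?powR_ge0// le0_ler_powR//; lra.
Qed.

(** Differentiating the identity in [u] under the integral sign brings down a factor [p], which is
    nonzero and can be cancelled. *)
Lemma powR_kernel_integral_eq0S (p : R) : p < 0 ->
  (forall u, b < u -> \int[lebesgue_measure]_(t in `]a, b[) ((u - t) `^ p * y t) = 0) ->
  forall u, b < u ->
    \int[lebesgue_measure]_(t in `]a, b[) ((u - t) `^ (p - 1) * y t) = 0.
Proof.
move=> p0 int0 u bu.
pose f (u t : R) : R := (u - t) `^ p * y t.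
(* Keeping the parameter above this midpoint bounds its distance to []a, b[] below by [v - b > 0],
   which yields a dominating function independent of the parameter. *)
pose v := (u + b) / 2.
have df (s t : R) : t < s -> is_derive s 1 (f ^~ t) (p * (s - t) `^ (p - 1) * y t).
  move=> ts.
  have st0 : 0 < s - t by lra.
  have := is_derive1_powR p st0 => H1.
  have H2 : is_derive s (1:R) (fun u : R => u - t) 1.
    by apply: is_derive_eq; rewrite subr0.
  have H3 := @is_derive1_comp _ (fun z : R => z `^ p) (fun u : R => u - t) s _ _ H1 H2.
  rewrite /f; apply: is_derive_eq.
  by rewrite scaler0 add0r /GRing.scale /=; ring.
have Iu : `]v, u + 1[%classic u by rewrite /= in_itv /= /v; lra.
have d1 (s t : R) : t < s -> partial1of2 f s t = p * (s - t) `^ (p - 1) * y t.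
  by move=> ts; rewrite partial1of2E; rewrite (@derive_val _ _ _ _ _ _ _ (df s t ts)).
have iG : lebesgue_measure.-integrable `]a, b[
    (EFin \o (fun t => `|p| * (v - b) `^ (p - 1) * `|y t| : R)).
  apply: (@integrable_bounded_mul _ _ _ _ _ _ _ (`|p| * (v - b) `^ (p - 1))) => //.
    by move=> t _; rewrite ger0_norm// mulr_ge0 ?powR_ge0.
  exact: integrable_norm.
have intf s : `]v, u + 1[%classic s ->
    lebesgue_measure.-integrable `]a, b[ (EFin \o f s).
  rewrite /= in_itv /= => /andP[vs _]; apply: integrable_powR_kernel; first exact: ltW.
  by move: vs; rewrite /v; lra.
have derf s t : `]v, u + 1[%classic s -> `]a, b[%classic t -> derivable (f ^~ t) s 1.
  rewrite /= !in_itv /= => /andP[vs _] /andP[_ tb].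
  have ts : t < s by move: vs; rewrite /v; lra.
  by case: (df s t ts).
have G_ge0 t : 0 <= `|p| * (v - b) `^ (p - 1) * `|y t|.
  by rewrite !mulr_ge0 ?powR_ge0.
have G_ub s t : `]v, u + 1[%classic s -> `]a, b[%classic t ->
    `|partial1of2 f s t| <= `|p| * (v - b) `^ (p - 1) * `|y t|.
  rewrite /= !in_itv /= => /andP[vs _] /andP[_ tb].
  have vb : b < v by rewrite /v; lra.
  have ts : t < s by lra.
  rewrite d1// !normrM ler_wpM2r// ler_wpM2l// ger0_norm ?powR_ge0//.
  by rewrite le0_ler_powR//; lra.
have /esym := @differentiation_under_integral R _ _ (@lebesgue_measure R) f _
  (measurable_itv `]a, b[) _ _ _ Iu intf derf _ G_ge0 iG G_ub.
(* The integral is zero for all parameters near [u], so its derivative at [u] is zero. *)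
rewrite derive1E (@near_eq_derive _ _ _ _ (cst 0)) ?derive_cst ?oner_neq0//; last first.
  by near=> s; apply: int0; near: s; exact: lt_nbhsr.
have -> : \int[lebesgue_measure]_(t in `]a, b[) partial1of2 f u t =
    \int[lebesgue_measure]_(t in `]a, b[) (p * ((u - t) `^ (p - 1) * y t)).
  apply: eq_Rintegral => t /set_mem /=; rewrite in_itv /= => /andP[_ tb].
  by rewrite d1 ?mulrA//; lra.
rewrite RintegralZl//; last by apply: integrable_powR_kernel => //; lra.
by move/eqP; rewrite mulf_eq0 (lt_eqF p0) /= => /eqP.
Unshelve. all: by end_near. Qed.

Lemma powR_kernel_moments (p : R) : p < 0 ->
  (forall u, b < u -> \int[lebesgue_measure]_(t in `]a, b[) ((u - t) `^ p * y t) = 0) ->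
  forall k u, b < u ->
    \int[lebesgue_measure]_(t in `]a, b[) ((u - t) `^ (p - k%:R) * y t) = 0.
Proof.
move=> p0 int0; elim=> [|k IH] u bu; first by rewrite subr0; exact: int0.
rewrite -natr1 opprD addrA; apply: powR_kernel_integral_eq0S => //.
by rewrite subr_lt0 (lt_le_trans p0).
Qed.

End power_kernel.

(** * Translation of Lebesgue integrals *)

(** Lebesgue measure equals its pushforward under translation, by uniqueness from the values on
    half-open intervals. Integrability is asked of the translated function because the change of
    variables takes it in that form. *)
Lemma Rintegral_shift (R : realType) (D : set R) (f : R -> R) (c : R) :
  measurable D -> measurable_fun D f ->
  lebesgue_measure.-integrable [set t | D (t + c)] (EFin \o (fun t => f (t + c))) ->
  \int[lebesgue_measure]_(t in D) f t =
  \int[lebesgue_measure]_(t in [set t | D (t + c)]) f (t + c).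
Proof.
move=> mD mf ifc.
pose phi : measurableTypeR R -> measurableTypeR R := fun t : R => t + c.
have mphi : measurable_fun [set: measurableTypeR R] phi.
  by apply: measurable_funD => //; exact: measurable_id.
have eqmu A : measurable A -> lebesgue_measure A = pushforward lebesgue_measure phi A.
  unshelve (apply: lebesgue_measure_unique) => // X /ocitvP[->|[[u v] /= uv ->]].
    by rewrite !measure0.
  rewrite /= /pushforward (_ : _ @^-1` _ = `]u - c, v - c]%classic); last first.
    by apply/seteqP; split => t /=; rewrite !in_itv /= /phi; lra.
  rewrite !lebesgue_measure_itv /= !lte_fin ltrD2r.
  by rewrite -!EFinB; case: ifP => // _; congr EFin; ring.
have mphiD : measurable (phi @^-1` D) by rewrite -[X in measurable X]setTI; exact: mphi.
have E : (EFin \o f) \_ D \o phi = (EFin \o (f \o phi)) \_ (phi @^-1` D).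
  by apply/funext => t; rewrite /= !patchE.
rewrite /Rintegral; congr fine.
rewrite integral_mkcond.
transitivity (\int[pushforward lebesgue_measure phi]_t ((EFin \o f) \_ D) t)%E.
  by apply: eq_measure_integral => A mA _; exact: eqmu.
rewrite (integral_pushforward mphi)//.
- by rewrite preimage_setT E -integral_mkcond.
- apply: (measurable_restrict _ _ _).1 => //.
  by apply/measurable_EFinP; rewrite setTI.
- by rewrite preimage_setT E; exact: (integrable_mkcond _ _).1.
Qed.

(** * Positivity of the Gamma function on the open unit interval *)

Lemma powR_le1D (R : realType) (z s : R) : 0 < z < 1 -> 0 < s -> s `^ z <= 1 + s.
Proof.
move=> /andP[z0 z1] s0; have [s1|s1] := leP s 1.
  apply: (@le_trans _ _ (1 `^ z)); last by rewrite powR1; lra.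
  by apply: (ge0_ler_powR _ _ _ s1); rewrite ?nnegrE ltW.
apply: (@le_trans _ _ (s `^ 1)); first by rewrite ler_powR// ltW.
by rewrite powRr1 ltW//; lra.
Qed.

Lemma is_derive_expRNpowR (R : realType) (z s : R) : 0 < s ->
  is_derive s 1 (fun s : R => - expR (- (s `^ z)))
    (z * s `^ (z - 1) * expR (- (s `^ z))).
Proof.
move=> s0.
have H := is_derive1_powR z s0.
have H2 : is_derive s 1 (fun s : R => - (s `^ z)) (- (z * s `^ (z - 1))).
  exact: is_deriveN.
have H3 := @is_derive1_comp _ expR (fun s : R => - (s `^ z)) s _ _
  (is_derive_expR _) H2.
apply: (is_derive_eq (is_deriveN H3)).
by ring.
Qed.

(* Since [s `^ z <= 1 + s], the integrand is at most [expR 1 / z] times the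
   derivative of [- expR (- s `^ z)], whose total variation is at most 1. *)
Lemma Gamma_integrand_integral_le (R : realType) (z a b : R) : 0 < z < 1 ->
  0 < a < b ->
  (\int[lebesgue_measure]_(s in `[a, b]) (s `^ (z - 1) * expR (- s))%:E <=
   (expR 1 / z)%:E)%E.
Proof.
move=> /andP[z0 z1] /andP[a0 ab].
pose g (s : R) := z * s `^ (z - 1) * expR (- (s `^ z)).
have dG (s : R) : 0 < s -> derivable (fun s : R => - expR (- (s `^ z))) s 1.
  by move=> s0; case: (is_derive_expRNpowR z s0).
have cG (s : R) : 0 < s -> {for s, continuous (fun s : R => - expR (- (s `^ z)))}.
  by move=> s0; apply/differentiable_continuous; rewrite -derivable1_diffP; exact: dG.
have dg (s : R) : 0 < s -> derivable g s 1.
  move=> s0.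
  have [d1 _] := is_derive1_powR (z - 1) s0.
  have dE : derivable (fun s : R => expR (- (s `^ z))) s 1.
    rewrite (_ : (fun _ => _) = - (fun s : R => - expR (- (s `^ z)))).
      exact: derivableN (dG _ s0).
    by apply/funext => t; rewrite fctE opprK.
  by apply: derivableM => //; apply: derivableM.
have cg : {within `[a, b], continuous g}.
  apply: derivable_within_continuous => s; rewrite in_itv /= => /andP[as_ _].
  by apply: dg; lra.
have FTC : (\int[lebesgue_measure]_(s in `[a, b]) (g s)%:E <= 1%:E)%E.
  rewrite (@continuous_FTC2 R g (fun s : R => - expR (- (s `^ z))) _ _ ab cg).
  - rewrite -EFinB lee_fin opprK.
    have : expR (- (a `^ z)) <= 1 by rewrite -expR0 ler_expR oppr_le0 powR_ge0.
    by have := expR_gt0 (- (b `^ z)); lra.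
  - split.
    + by move=> s; rewrite in_itv /= => /andP[as_ _]; apply: dG; lra.
    + by apply: cvg_at_right_filter; exact: cG.
    + by apply: cvg_at_left_filter; apply: cG; lra.
  - move=> s; rewrite in_itv /= => /andP[as_ _].
    have s0 : 0 < s by lra.
    by rewrite derive1E (@derive_val _ _ _ _ _ _ _ (is_derive_expRNpowR z s0)).
have mgf : measurable_fun `[a, b] g by exact: subspace_continuous_measurable_fun.
apply: (@le_trans _ _ (\int[lebesgue_measure]_(s in `[a, b])
    ((expR 1 / z)%:E * (g s)%:E))%E).
  apply: ge0_le_integral => //.
  - by move=> s _; rewrite lee_fin mulr_ge0 ?powR_ge0 ?expR_ge0.
  - apply/measurable_EFinP; apply: measurable_funM.
      by apply: measurable_funTS; exact: measurable_powR.
    by apply: measurableT_comp => //; exact: measurable_funN.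
  - by apply/measurable_EFinP; exact: measurable_funM.
  - move=> s /=; rewrite in_itv /= => /andP[as_ _].
    have s0 : 0 < s by lra.
    rewrite lee_fin /g.
    have -> : expR 1 / z * (z * s `^ (z - 1) * expR (- s `^ z)) =
        s `^ (z - 1) * expR (1 - s `^ z).
      by rewrite expRD; field; lra.
    rewrite ler_wpM2l ?powR_ge0// ler_expR.
    by have := @powR_le1D R z s; rewrite z0 z1 => /(_ isT s0); lra.
rewrite ge0_integralZl//.
- rewrite -[leRHS]mule1 lee_wpmul2l// lee_fin divr_ge0 ?expR_ge0// ltW//.
- exact/measurable_EFinP.
- by move=> s _; rewrite lee_fin /g !mulr_ge0 ?powR_ge0 ?expR_ge0// ltW.
- by rewrite lee_fin divr_ge0 ?expR_ge0// ltW.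
Qed.

(** An upper bound is needed as well as a lower one: [Rintegral] goes through [fine], which sends an
    infinite integral to 0. *)
Lemma Gamma_gt0 (R : realType) (z : R) : 0 < z < 1 -> 0 < Gamma z.
Proof.
move=> z01; have [z0 z1] := andP z01.
pose f (s : R) := s `^ (z - 1) * expR (- s).
have f0 s : 0 <= f s by rewrite mulr_ge0 ?powR_ge0 ?expR_ge0.
have mf D : measurable_fun D (EFin \o f).
  apply/measurable_EFinP; apply: measurable_funM.
    by apply: measurable_funTS; exact: measurable_powR.
  by apply: measurableT_comp => //; exact: measurable_funN.
set I := (\int[lebesgue_measure]_(s in `]0%R, +oo[) (f s)%:E)%E.
have Ile : (I <= (expR 1 / z)%:E)%E.
  (* Compact intervals exhausting the half-line; starting from 2 makes the endpoints distinct
     already for [n = 0]. *)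
  pose F n : set R := `[(n.+2%:R)^-1, n.+2%:R]%classic.
  have FU : \bigcup_n F n = `]0, +oo[%classic.
    apply/seteqP; split => s /=.
      move=> [n _]; rewrite /F /= !in_itv /= => /andP[ns _].
      by rewrite andbT (lt_le_trans _ ns)// invr_gt0.
    rewrite in_itv /= andbT => s0.
    exists (maxn (Num.trunc s) (Num.trunc s^-1)) => //.
    rewrite /F /= in_itv /=; apply/andP; split.
      rewrite -[leRHS]invrK lef_pV2 ?posrE ?invr_gt0//.
      apply: le_trans (ltW (truncnS_gt _)) _.
      by rewrite ler_nat ltnS leqW// leq_maxr.
    apply: le_trans (ltW (truncnS_gt _)) _.
    by rewrite ler_nat ltnS leqW// leq_maxl.
  have H : (\int[lebesgue_measure]_(x in F i) (f x)%:E)%E @[i --> \oo] --> I.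
    rewrite /I -FU; apply: ge0_nondecreasing_set_cvg_integral => //.
    - move=> n m nm; apply/subsetPset => s; rewrite /F /= !in_itv /=.
      move=> /andP[ns sn]; apply/andP; split.
        by apply: le_trans ns; rewrite lef_pV2 ?posrE// ler_nat.
      by apply: (le_trans sn); rewrite ler_nat.
    - by move=> n; exact: measurable_itv.
    - by move=> n; exact: mf.
    - by move=> n s _; rewrite lee_fin.
  apply: (cvge_le _ H).
  apply: nearW => n; apply: Gamma_integrand_integral_le => //.
  rewrite invr_gt0 ltr0n /= (@lt_trans _ _ 1)//.
    by rewrite invf_lt1// ltr1n.
  by rewrite ltr1n.
(* Both factors of the integrand decrease, so its value at 2 bounds it from below on [[1, 2]], an
   interval of length 1. *)
pose c := 2 `^ (z - 1) * expR (- 2).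
have c0 : 0 < c by rewrite mulr_gt0 ?powR_gt0 ?expR_gt0.
have cI : (c%:E <= I)%E.
  apply: (@le_trans _ _ (\int[lebesgue_measure]_(s in `[1%R, 2%R]) (f s)%:E)%E);
      last first.
    apply: ge0_subset_integral => //; first exact: mf.
      by move=> s _; rewrite lee_fin.
    by move=> s /=; rewrite !in_itv /= andbT => /andP[? _]; lra.
  apply: (@le_trans _ _ (\int[lebesgue_measure]_(s in `[1%R, 2%R]) c%:E)%E).
    rewrite integral_cst//= lebesgue_measure_itv /= lte_fin ltr1n.
    by rewrite -EFinB -EFinM lee_fin; lra.
  apply: ge0_le_integral => //.
  - by move=> s _; rewrite lee_fin ltW.
  - exact: mf.
  move=> s /=; rewrite in_itv /= => /andP[s1 s2]; rewrite lee_fin.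
  by rewrite ler_pM ?powR_ge0 ?expR_ge0 ?ler_expR ?le0_ler_powR//; lra.
have : I \is a fin_num.
  by rewrite ge0_fin_numE; [exact: le_lt_trans Ile (ltry _)|
    apply: le_trans cI; rewrite lee_fin ltW].
rewrite /Gamma /Rintegral -/I => /fineK IE.
by move: cI; rewrite -IE lee_fin; exact: lt_le_trans.
Qed.

(** * Periodic solutions *)

Lemma ae_neq (R : realType) (c : R) : {ae lebesgue_measure, forall t : R, t != c}.
Proof.
exists [set c]; split; [exact: measurable_set1|exact: lebesgue_measure_set1|].
by move=> t /= /negP; rewrite negbK => /eqP.
Qed.

(** At [u = 2 * T] the kernel is positive on []0, T[], so it suffices to kill [z]. Each []0, s[] is
    a sublevel set of a multiple of [1 / (2 * T - t)], so [moments_eq0] makes all initial integrals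
    of [z] vanish. *)
Lemma powR_kernel_eq0_ae (R : realType) (T p : R) (y : R -> R) :
  0 < T -> p < 0 ->
  lebesgue_measure.-integrable `]0, T[ (EFin \o y) ->
  (forall u, T < u ->
    \int[lebesgue_measure]_(t in `]0, T[) ((u - t) `^ p * y t) = 0) ->
  {ae lebesgue_measure, forall t, 0 < t < T -> y t = 0}.
Proof.
move=> T0 p0 iy int0.
have T2 : T < 2 * T by lra.
pose z t := (2 * T - t) `^ p * y t.
have iz : lebesgue_measure.-integrable `]0, T[ (EFin \o z).
  by apply: integrable_powR_kernel => //; exact: ltW.
suff : {ae lebesgue_measure, forall t, 0 < t < T -> z t = 0}.
  apply: filterS; first exact: (ae_filter_ringOfSetsType lebesgue_measure).
  move=> t + tT => /(_ tT) /eqP; rewrite mulf_eq0 => /orP[|/eqP//].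
  by rewrite gt_eqF// powR_gt0//; lra.
apply: itv_integral_eq0_ae => // s /andP[s0 sT].
(* The endpoint is dropped because [moments_eq0] speaks of the strict sublevel set. *)
have -> : \int[lebesgue_measure]_(t in `]0, s]) z t =
    \int[lebesgue_measure]_(t in `]0, s[) z t.
  apply/esym/Rintegral_itv_bndo_bndc; apply: integrableS iz => //.
  by apply: subset_itvl; rewrite bnd_simp ltW.
pose c := (2 * T - s) / 2.
(* [q] takes its values in [0, 1], and [q t < 1/2] exactly when [t < s]. *)
pose q t := c * (2 * T - t) `^ (- 1).
have qE t : t < T -> q t = c / (2 * T - t) by move=> tT; rewrite /q powR_inv1//; lra.
rewrite (_ : `]0, s[%classic = `]0, T[%classic `&` [set t | q t < 1/2]); last first.
  apply/seteqP; split => t /=; rewrite !in_itv /=.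
    move=> /andP[t0 ts]; rewrite t0 /= (lt_trans ts)//; split=> //.
    by rewrite qE ?ltr_pdivrMr /c; lra.
  move=> [/andP[t0 tT]]; rewrite t0 /= qE// ltr_pdivrMr /c; lra.
apply: moments_eq0 => //.
- apply: measurable_funM => //.
  by apply: (measurableT_comp (measurable_powR (- 1))); exact: measurable_funB.
- move=> t /=; rewrite in_itv /= => /andP[t0 tT]; rewrite qE//.
  by rewrite divr_ge0 ?ler_pdivrMr /c; lra.
- have := ae_neq s; apply: filterS.
    exact: (ae_filter_ringOfSetsType lebesgue_measure).
  move=> t ts; rewrite /= in_itv /= => /andP[t0 tT]; rewrite qE//.
  apply: contra ts => /eqP E; apply/eqP.
  have /(congr1 (fun v => v * (2 * T - t))) := E.
  by rewrite divfK /c; lra.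
(* Up to the constant [c ^+ k], the moment of order [k] is the kernel integral with exponent
   [p - k]. *)
- move=> k.
  have -> : \int[lebesgue_measure]_(t in `]0, T[) (q t ^+ k * z t) =
      \int[lebesgue_measure]_(t in `]0, T[) (c ^+ k * ((2 * T - t) `^ (p - k%:R) * y t)).
    apply: eq_Rintegral => t /set_mem /=; rewrite in_itv /= => /andP[t0 tT].
    have Tt : 0 < 2 * T - t by lra.
    rewrite /z qE// exprMn powRD; last by apply/implyP => _; rewrite gt_eqF.
    by rewrite powR_invn ?ltW// exprVn; ring.
  rewrite RintegralZl//; last first.
    by apply: integrable_powR_kernel => //; rewrite subr_le0 (le_trans (ltW p0)).
  by rewrite (powR_kernel_moments iy p0 int0) ?mulr0.
Qed.

(** Chain rule for the translation; [t > 0] makes the periodicity relation hold on a full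
    neighbourhood of [t]. *)
Lemma derive1_periodic (R : realType) (x : R -> R) (T t : R) :
  (forall s, 0 <= s -> x (s + T) = x s) -> 0 < t -> derivable x (t + T) 1 ->
  derive1 x (t + T) = derive1 x t.
Proof.
move=> xT t0 dx.
have H1 : is_derive (t + T) 1 x (derive1 x (t + T)).
  by apply: DeriveDef => //; rewrite derive1E.
have H2 : is_derive t (1 : R) (fun s : R => s + T) 1.
  by apply: is_derive_eq; rewrite addr0.
have H3 := @is_derive1_comp _ x (fun s : R => s + T) t _ _ H1 H2.
rewrite [RHS]derive1E -(@near_eq_derive _ _ _ (x \o (fun s => s + T))) ?oner_neq0//.
  by rewrite (@derive_val _ _ _ _ _ _ _ H3) mulr1.
near=> s; apply: xT; apply: ltW; near: s; exact: lt_nbhsr.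
Unshelve. all: by end_near. Qed.

(** Cut []0, u]] at [T]: the part beyond [T] translates to the integral of [h], so the part before
    [T] contributes nothing. *)
Lemma Rintegral_period_eq0 (R : realType) (g h : R -> R) (T u : R) : 0 < T < u ->
  lebesgue_measure.-integrable `]0, u] (EFin \o g) ->
  lebesgue_measure.-integrable `]0, (u - T)] (EFin \o h) ->
  (forall t, 0 < t -> g (t + T) = h t) ->
  \int[lebesgue_measure]_(t in `]0, u]) g t =
    \int[lebesgue_measure]_(t in `]0, (u - T)]) h t ->
  \int[lebesgue_measure]_(t in `]0, T[) g t = 0.
Proof.
move=> /andP[T0 Tu] ig ih ghT gh.
have iT : lebesgue_measure.-integrable `]0, T] (EFin \o g).
  by apply: integrableS ig => //; apply: subset_itvl; rewrite bnd_simp ltW.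
have ioE : \int[lebesgue_measure]_(t in `]0, T[) g t =
    \int[lebesgue_measure]_(t in `]0, T]) g t.
  apply: Rintegral_itv_bndo_bndc; apply: integrableS iT => //.
  by apply: subset_itvl; rewrite bnd_simp.
have splitE : \int[lebesgue_measure]_(t in `]0, u]) g t -
    \int[lebesgue_measure]_(t in `]0, T]) g t =
    \int[lebesgue_measure]_(t in `]T, u]) g t.
  by apply: Rintegral_itvB ig _ _; rewrite bnd_simp ltW.
have shiftE : [set t | `]T, u]%classic (t + T)] = `]0, (u - T)]%classic.
  by apply/seteqP; split => t /=; rewrite !in_itv /=; lra.
have igT : lebesgue_measure.-integrable `]0, (u - T)] (EFin \o (fun t => g (t + T))).
  apply: eq_integrable ih => //.
  by move=> t /set_mem /=; rewrite in_itv /= => /andP[t1 _]; rewrite ghT.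
have mg : measurable_fun `]T, u] g.
  apply: (@measurable_funS _ _ _ _ `]0, u]) => //.
    by apply: subset_itvr; rewrite bnd_simp ltW.
  by have /integrableP[/measurable_EFinP] := ig.
have translateE : \int[lebesgue_measure]_(t in `]T, u]) g t =
    \int[lebesgue_measure]_(t in `]0, (u - T)]) h t.
  rewrite (Rintegral_shift (c := T) (measurable_itv `]T, u]) mg) shiftE//.
  by apply: eq_Rintegral => t /set_mem /=; rewrite in_itv /= => /andP[t1 _]; exact: ghT.
move: splitE; rewrite ioE translateE gh => /eqP.
by rewrite -subr_eq0 addrAC subrr sub0r oppr_eq0 => /eqP.
Qed.

(** The states at [u] and [u - T] agree, hence so do the Caputo values, and the nonzero Gamma factor
    cancels. Translation by [T] turns [K u] into [K (u - T)], so one period of memory must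
    vanish. *)
Lemma periodic_solution_kernel (R : realType) (alpha x0 T : R) (f x : R -> R) :
  0 < alpha < 1 -> caputo_solution alpha f x0 x ->
  0 < T -> (forall t : R, 0 <= t -> x (t + T) = x t) ->
  forall u, T < u ->
  \int[lebesgue_measure]_(t in `]0, T[) ((u - t) `^ (- alpha) * derive1 x t) = 0.
Proof.
move=> /andP[a0 a1] [dx _ iK cap _] T0 xT u Tu.
pose K v t : R := (v - t) `^ (- alpha) * derive1 x t.
(* The point 0 is removed because the periodicity of the derivative is available only at positive
   times. *)
have ioc v : 0 <= v -> lebesgue_measure.-integrable `]0, v] (EFin \o K v).
  move=> /iK; apply: integrableS; [exact: measurable_itv|exact: measurable_itv|].
  by apply: subset_itvr; rewrite bnd_simp.
have u0 : 0 <= u by exact: ltW (lt_trans T0 Tu).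
have t0 : 0 <= u - T by rewrite subr_ge0 ltW.
have G0 : (Gamma (1 - alpha))^-1 != 0.
  by rewrite invr_neq0// gt_eqF// Gamma_gt0//; lra.
have KE : \int[lebesgue_measure]_(t in `[0, u]) K u t =
    \int[lebesgue_measure]_(t in `[0, (u - T)]) K (u - T) t.
  have := cap _ t0; rewrite -(xT _ t0) subrK -(cap _ u0) => /(mulfI G0) KE.
  exact: esym KE.
have KT t : 0 < t -> K u (t + T) = K (u - T) t.
  move=> t_gt0; have tT : 0 < t + T by exact: addr_gt0.
  rewrite /K (derive1_periodic xT t_gt0 (dx _ tT)).
  by rewrite opprD addrA addrAC.
apply: (Rintegral_period_eq0 _ (ioc _ u0) (ioc _ t0) KT); first by rewrite T0.
have E1 : \int[lebesgue_measure]_(t in `]0, u]) K u t =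
    \int[lebesgue_measure]_(t in `[0, u]) K u t.
  exact: Rintegral_itv_obnd_cbnd (ioc _ u0).
have E2 : \int[lebesgue_measure]_(t in `]0, (u - T)]) K (u - T) t =
    \int[lebesgue_measure]_(t in `[0, (u - T)]) K (u - T) t.
  exact: Rintegral_itv_obnd_cbnd (ioc _ t0).
by rewrite E1 E2; exact: KE.
Qed.

Lemma periodic_solution_cst (R : realType) (alpha x0 T : R) (f x : R -> R) :
  0 < alpha < 1 -> caputo_solution alpha f x0 x ->
  0 < T -> (forall t : R, 0 <= t -> x (t + T) = x t) ->
  forall t : R, 0 <= t -> x t = x 0.
Proof.
move=> alpha01 sol T0 xT t.
have kernel0 := periodic_solution_kernel alpha01 sol T0 xT.
have [dx iy _ _ _] := sol; move: sol => _.
have y0 : {ae lebesgue_measure, forall t, 0 < t < T -> derive1 x t = 0}.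
  apply: (@powR_kernel_eq0_ae _ _ (- alpha)) => //.
  - by rewrite oppr_lt0; case/andP: alpha01.
  - apply: integrableS (iy T (ltW T0)) => //.
    by apply: subset_itvScc; rewrite bnd_simp.
have xcst (s : R) : 0 <= s <= T -> x s = x 0.
  move=> /andP[]; rewrite le_eqVlt => /predU1P[<-//|s0] sT.
  (* Derivability is known only at positive times, so [x s] is compared with [x T], which equals
     [x 0], on [[s, T]]. *)
  rewrite -[RHS](xT 0 (lexx _)) add0r; apply: ae_derive1_eq0_eq => //.
    by move=> v /andP[sv _]; apply: dx; lra.
  move: (ae_neq T) y0; apply: filterS2.
    exact: (ae_filter_ringOfSetsType lebesgue_measure).
  by move=> v vT H /andP[sv vT']; apply: H; rewrite (lt_le_trans s0 sv) lt_neqAle vT.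
have xnT n (s : R) : 0 <= s -> x (s + n%:R * T) = x s.
  move=> s0; elim: n => [|n IH]; first by rewrite mul0r addr0.
  by rewrite -natr1 mulrDl mul1r addrA xT// addr_ge0// mulr_ge0// ltW.
(* Subtracting [n] whole periods brings [t] into the first one. *)
move=> t0; pose n := Num.trunc (t / T).
have /andP[nt tn] : n%:R <= t / T < n.+1%:R by apply: truncn_itv; rewrite divr_ge0// ltW.
have r0 : 0 <= t - n%:R * T by rewrite subr_ge0 -ler_pdivlMr.
rewrite -[t](subrK (n%:R * T)) xnT// xcst// r0 /=.
by move: tn; rewrite ltr_pdivrMr// -natr1 mulrDl mul1r; lra.
Qed.

Theorem theorem5p1 (R : realType) (alpha : R) (f : R -> R) (x0 : R) :
  0 < alpha < 1 ->
  ~ (exists x : R -> R,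
       [/\ caputo_solution alpha f x0 x, periodic_on_nonneg x
         & nonconstant_on_nonneg x]).
Proof.
move=> alpha01 [x [sol [T [T0 xT]] [t1 [t2 [t1_ge0 t2_ge0]]]]]; apply.
by rewrite !(periodic_solution_cst alpha01 sol T0 xT).
Qed.
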